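(* Let $\mathbb{K}$ be a field of characteristic $0$. If $G$ is a forest (a finite acyclic simple graph) or a cycle graph on $n\ge 3$ vertices, then the Artinian Orlik-Terao algebra $\mathrm{AOT}(G)$ over $\mathbb{K}$ has the Weak Lefschetz Property.
   Context: Artinian Orlik-Terao (AOT) algebra of a graph: let $G$ be a finite simple graph with vertices $1,\dots,n$ and edges $e_1,\dots,e_d$. Its graphic arrangement consists of the hyperplanes $H_t=V(\ell_t)$, where $\ell_t=x_i-x_j$ for the edge $e_t=(i,j)$, $i<j$. Let $S=\mathbb{K}[y_1,\dots,y_d]$. For each subset $\Lambda=\{i_1,\dots,i_k\}\subseteq\{1,\dots,d\}$ with $\mathrm{codim}(H_{i_1}\cap\dots\cap H_{i_k})<k$ and each nontrivial linear relation $\sum_{t\in\Lambda}c_t\ell_t=0$ with $c_t\in\mathbb{K}$, put $f_\Lambda=\sum_{j=1}^k c_{i_j}\,y_{i_1}\cdots\widehat{y_{i_j}}\cdots y_{i_k}$. Then $\mathrm{AOT}(G)$ is the quotient of $S$ by the ideal generated by all such $f_\Lambda$ together with $y_1^2,\dots,y_d^2$ (a standard graded Artinian algebra). Weak Lefschetz Property (WLP): a graded Artinian quotient $A=S/I$ has WLP if there is a linear form $\ell\in S_1$ such that for all $i$ the multiplication map $\mu_\ell:A_i\to A_{i+1}$, $a\mapsto \ell a$, has maximal rank, i.e. is injective or surjective. *)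

(* Defs.v *)
From HB Require Import structures.
From mathcomp Require Import all_boot all_order all_algebra.
From mathcomp Require Import perm boolp.
From mathcomp Require Import mpoly.

Set Implicit Arguments.
Unset Strict Implicit.
Unset Printing Implicit Defensive.

Import GRing.Theory.
Local Open Scope ring_scope.
Local Open Scope quotient_scope.

(* A finite simple graph with vertex set 'I_n and edges numbered by 'I_d, in an
   arbitrary order; each edge {i, j} is stored as the pair (i, j) with i < j. *)
Record graph (n d : nat) := Graph {
  edge :> 'I_d -> 'I_n * 'I_n;
  edge_lt : forall t, ((edge t).1 < (edge t).2)%N;
  edge_inj : injective edge
}.

Definition adj n d (G : graph n d) : rel 'I_n :=
  fun i j => [exists t, (G t == (i, j)) || (G t == (j, i))].

(* [ucycle] also accepts the empty sequence and the back-and-forth walk x, y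
   along a single edge, hence the bound on the length of a genuine cycle. *)
Definition is_forest n d (G : graph n d) : Prop :=
  forall p : seq 'I_n, ucycle (adj G) p -> (size p < 3)%N.

(* G is isomorphic to the cycle 0 - 1 - ... - (n-1) - 0. *)
Definition is_cycle_graph n d (G : graph n d) : Prop :=
  (3 <= n)%N /\
  exists s : {perm 'I_n},
    forall i j, adj G (s i) (s j) = (j == ordS i) || (i == ordS j).

Definition ideal_gen (R : comNzRingType) (gens : R -> Prop) (p : R) : Prop :=
  exists (m : nat) (c g : 'I_m -> R),
    (forall k, gens (g k)) /\ p = \sum_(k < m) c k * g k.

Lemma ideal_gen0 (R : comNzRingType) (gens : R -> Prop) : ideal_gen gens 0.
Proof. by exists 0%N, (fun=> 0), (fun=> 0); split=> [[]|] //; rewrite big_ord0. Qed.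

Lemma ideal_genMD (R : comNzRingType) (gens : R -> Prop) (a u v : R) :
  ideal_gen gens u -> ideal_gen gens v -> ideal_gen gens (a * u + v).
Proof.
move=> [m1 [c1 [g1 [g1P ->]]]] [m2 [c2 [g2 [g2P ->]]]].
exists (m1 + m2)%N.
exists (fun k => match split k with inl k1 => a * c1 k1 | inr k2 => c2 k2 end).
exists (fun k => match split k with inl k1 => g1 k1 | inr k2 => g2 k2 end).
split=> [k|]; first by case: split.
rewrite big_split_ord /= mulr_sumr; congr (_ + _); apply: eq_bigr => k _.
  by rewrite (unsplitK (inl _ k)) mulrA.
by rewrite (unsplitK (inr _ k)).
Qed.

Section AOT.
Variables (K : fieldType) (n d : nat) (G : graph n d).

(* The form x_i - x_j, as an element of the dual of K^n. *)
Definition ell (t : 'I_d) : 'Hom('rV[K]_n, K^o) :=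
  linfun (fun v : 'rV[K]_n => v 0 (G t).1 - v 0 (G t).2 : K^o).

Definition hyperplane (t : 'I_d) : {vspace 'rV[K]_n} := lker (ell t).

Definition codim (U : {vspace 'rV[K]_n}) : nat :=
  (\dim {: 'rV[K]_n} - \dim U)%N.

Definition dependent (L : {set 'I_d}) : bool :=
  (codim (\bigcap_(t in L) hyperplane t)%VS < #|L|)%N.

Definition nontrivial_relation (L : {set 'I_d}) (c : 'I_d -> K) : Prop :=
  \sum_(t in L) c t *: ell t = 0 /\ exists2 t, t \in L & c t != 0.

Definition OT_rel (L : {set 'I_d}) (c : 'I_d -> K) : {mpoly K[d]} :=
  \sum_(j in L) c j *: \prod_(t in L :\ j) 'X_t.

Variant AOT_gen : {mpoly K[d]} -> Prop :=
| AOT_square t : AOT_gen ('X_t ^+ 2)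
| AOT_dep L c of dependent L & nontrivial_relation L c : AOT_gen (OT_rel L c).

(* AOT(G) is the quotient ring {ideal_quot AOT_ideal}. *)
Definition AOT_ideal (p : {mpoly K[d]}) : bool := `[< ideal_gen AOT_gen p >].

Lemma ellE t v : ell t v = v 0 (G t).1 - v 0 (G t).2.
Proof.
pose f := fun v : 'rV[K]_n => v 0 (G t).1 - v 0 (G t).2 : K^o.
have f_lin : linear f.
  by move=> a u w; rewrite /f !mxE scalerBr opprD addrACA.
pose F := GRing.isLinear.Build _ _ _ _ f f_lin.
pose g : {linear 'rV[K]_n -> K^o} := HB.pack f F.
exact: (lfunE g v).
Qed.

Lemma ell_neq0 t : ell t != 0.
Proof.
apply/eqP => /lfunP /(_ (delta_mx 0 (G t).1)); rewrite ellE lfunE /= !mxE !eqxx.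
have /negPf-> : (G t).2 != (G t).1.
  by rewrite neq_ltn (edge_lt G t) orbT.
by rewrite subr0 => /eqP; rewrite oner_eq0.
Qed.

Lemma AOT_gen_homog p : AOT_gen p -> exists k, p \is k.+1.-homog.
Proof.
have homX t : ('X_t : {mpoly K[d]}) \is 1.-homog by rewrite dhomogX /= mdeg1.
case=> [t | L c _ [rel0 [t0 Lt0 nz_ct0]]].
  by exists 1%N; apply: (dhomogMn 2 (homX t)).
have homprod (A : {set 'I_d}) :
    (\prod_(t in A) 'X_t : {mpoly K[d]}) \is #|A|.-homog.
  rewrite -sum1_card.
  by elim/big_ind2: _ => [|? ? ? ? ? ?|t _]; [exact: dhomog1|exact: dhomogM|].
have L_gt1 : (1 < #|L|)%N.
  rewrite ltnNge; apply/negP => L_le1.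
  have defL : L = [set t0].
    by apply/esym/eqP; rewrite eqEcard sub1set Lt0 cards1.
  move/eqP: rel0; rewrite defL big_set1 scaler_eq0 (negPf nz_ct0) /=.
  by rewrite (negPf (ell_neq0 t0)).
exists #|L|.-2; apply: rpred_sum => j Lj; apply: rpredZ.
have -> : #|L|.-2.+1 = #|L :\ j|.
  by move: L_gt1; rewrite (cardsD1 j L) Lj add1n; case: #|_|.
exact: homprod.
Qed.

Lemma AOT_ideal_closed : idealr_closed AOT_ideal.
Proof.
split=> [||a u v].
- exact/asboolP/ideal_gen0.
- apply/negP => /asboolP[m [c [g [gP /(congr1 (mcoeff 0%MM))]]]].
  rewrite mcoeff1 eqxx raddf_sum big1 => [/eqP|k _]; first by rewrite oner_eq0.
  have [e /dhomog_nemf_coeff g0] := AOT_gen_homog (gP k).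
  by rewrite /= rmorphM /= (g0 0%MM) ?mulr0 //= mdeg0.
- by move=> /asboolP Iu /asboolP Iv; apply/asboolP/ideal_genMD.
Qed.

HB.instance Definition _ :=
  isIdealr.Build {mpoly K[d]} AOT_ideal AOT_ideal_closed.

End AOT.

Arguments AOT_ideal K {n d} G p.

Section WLP.
Variables (K : fieldType) (d : nat) (I : idealr {mpoly K[d]}).

Local Notation A := {ideal_quot I}.

(* The degree i component A_i of A = S / I, as the image of S_i; when I is
   homogeneous (see [AOT_gen_homog]), A is the direct sum of its components. *)
Definition graded_piece (i : nat) (a : A) : Prop :=
  exists2 p : {mpoly K[d]}, p \is i.-homog & a = \pi_A p.

Definition mul_injective (l : A) (i : nat) : Prop :=
  forall a b, graded_piece i a -> graded_piece i b -> l * a = l * b -> a = b.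

Definition mul_surjective (l : A) (i : nat) : Prop :=
  forall b, graded_piece i.+1 b -> exists2 a, graded_piece i a & b = l * a.

(* The Weak Lefschetz Property of the quotient A = S / I. *)
Definition WLP : Prop :=
  exists2 l : {mpoly K[d]}, l \is 1.-homog &
    forall i, mul_injective (\pi_A l) i \/ mul_surjective (\pi_A l) i.

End WLP.

(* Main.v *)
(** The squarefree algebra B = K[y_1..y_d]/(y_1^2, .., y_d^2) has the functions
    on subsets of {1..d} as a model, where multiplication by y_1 + .. + y_d is
    the raising operator of an sl2-triple; so B_i -> B_(i+1) is injective for
    2i < d and surjective for 2i + 2 > d. Every f_L comes from a linear relation
    whose nonzero coefficients form an edge set without vertices of degree 1.
    Forests have none, and in a cycle graph it consists of all d >= 3 edges, so
    that f_L has degree d - 1. Hence AOT(G) agrees with B in degrees i + 1 <= d/2,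
    where injectivity is needed, and surjectivity passes to quotients. *)
From HB Require Import structures.
Require Import Defs.
From mathcomp Require Import all_boot all_order all_algebra.
From mathcomp Require Import perm boolp mpoly ring.

Set Implicit Arguments.
Unset Strict Implicit.
Unset Printing Implicit Defensive.

Import GRing.Theory.
Local Open Scope ring_scope.
Local Open Scope quotient_scope.

Lemma natr_inj (K : fieldType) :
  [pchar K] =i pred0 -> injective (fun n => n%:R : K).
Proof.
move=> char0 m n; wlog le_mn : m n / (m <= n)%N.
  by move=> IH; have [/IH//|/ltnW/IH eq_nm /esym/eq_nm] := leqP m n.
move/esym/eqP; rewrite -subr_eq0 -natrB // (pcharf0P _).1 // subn_eq0 => le_nm.
by apply/eqP; rewrite eqn_leq le_mn.
Qed.

(** * Weight spaces of sl2 representations *)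

Section Sl2.
Variables (K : fieldType) (V : lmodType K) (U D H : {linear V -> V}).
(** [D], [H], [U] play the roles of e, h, f: [D] raises weights by 2 and [U] lowers them by 2. *)
Hypothesis commDU : forall v, D (U v) = U (D v) + H v.
Hypothesis commHD : forall v, H (D v) = D (H v) + D v *+ 2.
Hypothesis commHU : forall v, H (U v) = U (H v) - U v *+ 2.

Lemma iter_down_weight c k v :
  H v = c *: v -> H (iter k D v) = (c + (k.*2)%:R) *: iter k D v.
Proof.
move=> Hv; elim: k => [|k IHk]; first by rewrite addr0.
rewrite iterS commHD IHk linearZ /= doubleS -scaler_nat -scalerDl -!natr1.
by congr (_ *: _); ring.
Qed.

Lemma iter_up_weight c k v :
  H v = c *: v -> H (iter k U v) = (c - (k.*2)%:R) *: iter k U v.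
Proof.
move=> Hv; elim: k => [|k IHk]; first by rewrite subr0.
rewrite iterS commHU IHk linearZ /= doubleS -scaler_nat -scalerBl -!natr1.
by congr (_ *: _); ring.
Qed.

(** Each passage of [D] across [U] adds a weight c + 2j; for j from 0 to k these sum to (k + 1)(c +
    k). *)
Lemma iter_down_up c k v : H v = c *: v ->
  iter k.+1 D (U v) = U (iter k.+1 D v) + (k.+1%:R * (c + k%:R)) *: iter k D v.
Proof.
move=> Hv; elim: k => [|k IHk]; first by rewrite /= commDU Hv mul1r addr0.
rewrite iterS IHk linearD linearZ /= commDU -addrA -iterS (iter_down_weight _ Hv).
rewrite -scalerDl; congr (_ + _ *: _).
by rewrite -addnn natrD -!natr1; ring.
Qed.

Hypothesis char0 : [pchar K] =i pred0.

(** Descent on the power of [D]: once [U v] and D^(k+1) v vanish, [iter_down_up] leaves (k + 1)(m +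
    1 + k) D^k v = 0, whose factor is nonzero in characteristic 0. *)
Lemma up_injective m k v :
  H v = m.+1%:R *: v -> iter k D v = 0 -> U v = 0 -> v = 0.
Proof.
move=> Hv Dv0 Uv0; elim: k Dv0 => [//|k IHk] Dv0; apply: IHk.
have := iter_down_up k Hv; rewrite Uv0 Dv0 linear0 add0r -natrD -natrM.
have -> : iter k.+1 D 0 = 0 by elim: k.+1 => //= j ->; exact: linear0.
by move=> /esym/eqP; rewrite scaler_eq0 (pcharf0P _).1 //= => /eqP.
Qed.

(* By descending induction on k, D^k U^k v lies in the image of U. *)
Lemma up_surjective m k v :
  H v = - m.+1%:R *: v -> iter k U v = 0 ->
  exists2 g, H g = (2 - m.+1%:R) *: g & v = U g.
Proof.
move=> Hv Uv0.
suff: exists2 g, H g = (2 - m.+1%:R) *: g & iter 0 D (iter 0 U v) = U g by [].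
have : exists2 g, H g = (2 - m.+1%:R) *: g & iter k D (iter k U v) = U g.
  exists 0; first by rewrite linear0 scaler0.
  by rewrite Uv0 linear0; elim: k {Uv0} => //= j ->; exact: linear0.
elim: k {Uv0} => [//|k IHk] [g Hg DUg]; apply: IHk.
have HUv := iter_up_weight k Hv.
have := iter_down_up k HUv; rewrite -iterS DUg.
set c := _ * _.
(* U^k v has weight -(m + 1) - 2k, so [c] is -(k + 1)(m + 1 + k). *)
have nz_c : c != 0.
  have -> : c = - (k.+1 * (m.+1 + k))%:R.
    by rewrite /c natrM natrD -addnn natrD; ring.
  by rewrite oppr_eq0 (pcharf0P _).1.
move/eqP; rewrite addrC -subr_eq => /eqP/esym/(canRL (scalerK nz_c)) ->.
exists (c^-1 *: (g - iter k.+1 D (iter k U v))); last first.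
  by rewrite [RHS]linearZ; congr (_ *: _); rewrite linearB.
rewrite linearZ /= linearB -iterS Hg (iter_down_weight _ HUv).
have -> : - m.+1%:R - k.*2%:R + k.+1.*2%:R = 2 - m.+1%:R :> K.
  by rewrite doubleS -!natr1; ring.
by rewrite -scalerBr !scalerA mulrC.
Qed.
End Sl2.

(** * The Boolean lattice as an sl2 representation *)

Section BooleanLattice.
Variables (K : fieldType) (T : finType).
Local Notation V := {ffun {set T} -> K^o}.
Implicit Types (f g : V) (S : {set T}).

(** With [f] read as the squarefree polynomial with coefficients [f S], [up] is multiplication by
    the sum of the variables modulo their squares, and [down] is the sum of the partial
    derivatives. *)
Definition up f : V := [ffun S : {set T} => \sum_(t in S) f (S :\ t)].
Definition down f : V := [ffun S : {set T} => \sum_(t in ~: S) f (t |: S)].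
Definition weight f : V := [ffun S : {set T} => (#|T|%:R - (#|S|.*2)%:R) * f S].

Fact up_linear : linear up.
Proof.
move=> a f g; apply/ffunP => S; rewrite !ffunE scaler_sumr -big_split.
by apply: eq_bigr => t _; rewrite !ffunE.
Qed.
Fact down_linear : linear down.
Proof.
move=> a f g; apply/ffunP => S; rewrite !ffunE scaler_sumr -big_split.
by apply: eq_bigr => t _; rewrite !ffunE.
Qed.
Fact weight_linear : linear weight.
Proof.
by move=> a f g; apply/ffunP => S; rewrite !ffunE mulrDr scalerAr.
Qed.
HB.instance Definition _ := GRing.isLinear.Build K V V _ up up_linear.
HB.instance Definition _ := GRing.isLinear.Build K V V _ down down_linear.
HB.instance Definition _ := GRing.isLinear.Build K V V _ weight weight_linear.

(** Both composites contain the same exchange terms, in which some u in S gives way to some t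
    outside S; the terms in [f S] occur |T| - |S| times against |S| times. *)
Lemma down_up f : down (up f) = up (down f) + weight f.
Proof.
apply/ffunP => S; rewrite !ffunE.
have -> : \sum_(t in ~: S) up f (t |: S) =
    \sum_(t in ~: S) (f S + \sum_(u in S) f (t |: (S :\ u))).
  apply: eq_bigr => t; rewrite inE => tS.
  rewrite ffunE (big_setU1 _ tS) /= setU1K //; congr (_ + _).
  apply: eq_bigr => u uS; congr (f _); rewrite setDUl; congr (_ :|: _).
  by apply/setDidPl; rewrite disjoints1 inE; apply: contraNneq tS => ->.
have -> : \sum_(u in S) down f (S :\ u) =
    \sum_(u in S) (f S + \sum_(t in ~: S) f (t |: (S :\ u))).
  apply: eq_bigr => u uS; rewrite ffunE setCD setUC big_setU1 ?inE ?uS //=.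
  by rewrite setD1K.
rewrite !big_split /= !sumr_const exchange_big /= addrAC [RHS]addrC addrA.
rewrite addrC -addrA; congr (_ + _); rewrite -(cardsC S) -addnn !natrD.
by rewrite -[f S *+ #|S|]mulr_natl -[f S *+ _]mulr_natl; ring.
Qed.

Lemma weight_down f : weight (down f) = down (weight f) + down f *+ 2.
Proof.
apply/ffunP => S; rewrite !ffunE mulr_sumr -!big_split; apply: eq_bigr => t.
rewrite inE => tS; rewrite !ffunE cardsU1 tS /= doubleS -!natr1; ring.
Qed.

Lemma weight_up f : weight (up f) = up (weight f) - up f *+ 2.
Proof.
apply/ffunP => S; rewrite !ffunE mulr_sumr opprD -!sumrN -!big_split.
apply: eq_bigr => t tS.
rewrite !ffunE [in LHS](cardsD1 t) tS /= doubleS -!natr1; ring.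
Qed.

Lemma iter_down0 f : iter #|T|.+1 down f = 0.
Proof.
suff h k S : (#|T| < #|S| + k)%N -> iter k down f S = 0.
  by apply/ffunP => S; rewrite h ?ffunE // addnS ltnS leq_addl.
elim: k S => [|k IHk] S; first by rewrite addn0 ltnNge max_card.
move=> lt_T; rewrite iterS ffunE big1 // => t; rewrite inE => tS.
by rewrite IHk // cardsU1 tS addSnnS.
Qed.

Lemma iter_up0 f : iter #|T|.+1 up f = 0.
Proof.
suff h k S : (#|S| < k)%N -> iter k up f S = 0.
  by apply/ffunP => S; rewrite h ?ffunE // ltnS max_card.
elim: k S => [//|k IHk] S; rewrite ltnS => le_k.
rewrite iterS ffunE big1 // => t tS; apply: IHk.
by move: le_k; rewrite (cardsD1 t S) tS.
Qed.

Definition rank_homog k f := forall S, f S != 0 -> #|S| = k.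

Lemma rank_homog_weight k f :
  rank_homog k f -> weight f = (#|T|%:R - (k.*2)%:R) *: f.
Proof.
move=> hf; apply/ffunP => S; rewrite !ffunE.
by have [->|/hf ->] := eqVneq (f S) 0; rewrite ?scaler0 ?mulr0.
Qed.

Hypothesis char0 : [pchar K] =i pred0.

(** In characteristic 0 distinct ranks have distinct weights. *)
Lemma weight_rank_homog k f :
  weight f = (#|T|%:R - (k.*2)%:R) *: f -> rank_homog k f.
Proof.
move=> /ffunP hf S nz_fS; move: (hf S); rewrite !ffunE => /(mulIf nz_fS).
by move/addrI/oppr_inj/(natr_inj char0)/double_inj.
Qed.

Lemma up_inj k f : (k.*2 < #|T|)%N -> rank_homog k f -> up f = 0 -> f = 0.
Proof.
move=> lt_kT /rank_homog_weight wf.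
have wf' : weight f = (#|T| - k.*2.+1).+1%:R *: f.
  by rewrite wf subnSK // natrB // ltnW.
exact: up_injective down_up weight_down char0 _ _ _ wf' (iter_down0 f).
Qed.

Lemma up_surj k f : (#|T| < k.+1.*2)%N -> rank_homog k.+1 f ->
  exists2 g, rank_homog k g & f = up g.
Proof.
move=> lt_Tk /rank_homog_weight wf.
have wf' : weight f = - (k.+1.*2 - #|T|.+1).+1%:R *: f.
  by rewrite wf subnSK // natrB ?opprB // ltnW.
have [g wg fE] :=
  up_surjective down_up weight_down weight_up char0 wf' (iter_up0 f).
(* The weight of [g] exceeds that of [f] by 2, so it is |T| - 2k, which forces rank k. *)
exists g => //; apply: weight_rank_homog; rewrite [LHS]wg; congr (_ *: _).
by rewrite subnSK // natrB 1?ltnW // doubleS -!natr1; ring.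
Qed.

End BooleanLattice.

(** * Squarefree coefficients of polynomials *)

Lemma mcoeffMX_eq0 (R : nzRingType) n (p : {mpoly R[n]}) m k :
  ~~ (m <= k)%MM -> (p * 'X_[m])@_k = 0.
Proof.
move=> not_le; rewrite [p]mpolyE mulr_suml raddf_sum big1 // => j _ /=.
rewrite -scalerAl mcoeffZ -mpolyXD mcoeffX.
case: eqVneq => [E|]; last by rewrite mulr0.
by move: not_le; rewrite -E lem_addl.
Qed.

Section SquarefreePart.
Variables (K : fieldType) (d : nat).
Implicit Types (p q : {mpoly K[d]}) (S : {set 'I_d}).

(** [mesym1 S] is the indicator exponent of [S], so this is the quotient map onto B in the
    coordinates of the model. *)
Definition sqfree p : {ffun {set 'I_d} -> K^o} :=
  [ffun S : {set 'I_d} => p@_(mesym1 S)].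

Lemma sqfreeB p q : sqfree (p - q) = sqfree p - sqfree q.
Proof. by apply/ffunP => S; rewrite !ffunE mcoeffB. Qed.

Lemma mesym1_le S (A : {set 'I_d}) : (mesym1 A <= mesym1 S)%MM = (A \subset S).
Proof.
apply/mnm_lepP/subsetP => [le_AS t tA | sAS t].
  by have := le_AS t; rewrite !mnmE tA; case: (t \in S).
by rewrite !mnmE; have := sAS t; case: (t \in A) => // ->.
Qed.

Lemma mcoeff_mulX t p S : ('X_t * p)@_(mesym1 S) =
  if t \in S then p@_(mesym1 (S :\ t)) else 0.
Proof.
rewrite mulrC; case: ifP => [tS|/negbT tS]; last first.
  by apply: mcoeffMX_eq0; rewrite -mesym1_set1 mesym1_le sub1set.
rewrite -(mcoeffMX p U_(t)%MM); congr (_@__); apply/mnmP => u.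
rewrite !mnmE !inE eq_sym; case: (u =P t) => [->|]; rewrite ?eqxx ?tS //.
Qed.

Definition sum_vars : {mpoly K[d]} := \sum_(t < d) 'X_t.

Lemma sum_vars_homog : sum_vars \is 1.-homog.
Proof. by apply: rpred_sum => t _; rewrite dhomogX /= mdeg1. Qed.

Lemma sqfree_mul_sum_vars p : sqfree (sum_vars * p) = up (sqfree p).
Proof.
apply/ffunP => S; rewrite !ffunE mulr_suml raddf_sum [RHS]big_mkcond.
by apply: eq_bigr => t _; rewrite /= mcoeff_mulX ffunE.
Qed.

Lemma sqfree_homog k p : p \is k.-homog -> rank_homog k (sqfree p).
Proof.
move=> hp S; rewrite ffunE => nz; rewrite -mdeg_mesym1.
by rewrite (dhomog_mf hp) // mcoeff_msupp.
Qed.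

Lemma sqfree_lift k g : rank_homog k g ->
  exists2 q, q \is k.-homog & sqfree q = g.
Proof.
move=> hg; exists (\sum_(S : {set 'I_d}) g S *: 'X_[mesym1 S]).
  apply: rpred_sum => S _; have [->|/hg gS] := eqVneq (g S) 0.
    by rewrite scale0r rpred0.
  by rewrite rpredZ // dhomogX /= mdeg_mesym1 gS.
apply/ffunP => S; rewrite ffunE raddf_sum (bigD1 S) //= big1 => [|A ne_AS].
  by rewrite mcoeffZ mcoeffX eqxx mulr1 addr0.
by rewrite mcoeffZ mcoeffX (inj_eq (@inj_mesym1 d)) (negPf ne_AS) mulr0.
Qed.

End SquarefreePart.

(** * The defining ideal and a criterion for the Lefschetz property *)

Lemma pi_eqP (R : comNzRingType) (I : idealr R) (p q : R) :
  reflect ((\pi p)%qT = (\pi q)%qT :> {ideal_quot I}) (p - q \in I).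
Proof. by rewrite Quotient.idealrBE; apply: eqP. Qed.

Section AOTIdeal.
Variables (K : fieldType) (n d : nat) (G : graph n d).
Local Notation I := (AOT_ideal K G).
Local Notation A := {ideal_quot (I : idealr {mpoly K[d]})}.
Implicit Types (p q : {mpoly K[d]}) (S : {set 'I_d}).

Lemma AOT_ideal_gen p : AOT_gen G p -> p \in I.
Proof.
move=> Gp; apply/asboolP; exists 1%N, (fun=> 1), (fun=> p).
by split=> //; rewrite big_ord1 mul1r.
Qed.

(** Every monomial of such a [p] is divisible by the square of a variable. *)
Lemma sqfree0_AOT_ideal p : sqfree p = 0 -> p \in I.
Proof.
move=> /ffunP p0; rewrite [p]mpolyE big_seq; apply: rpred_sum => m.
rewrite mcoeff_msupp => nz_pm; rewrite -mul_mpolyC idealMr //.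
have [t gt1] : exists t, (1 < m t)%N.
  apply/existsP; apply: contraNT nz_pm => /existsPn le1.
  have -> : m = mesym1 [set t | m t == 1%N].
    apply/mnmP => t; rewrite mnmE inE.
    by have := le1 t; case: (m t) => [|[|]].
  by have := p0 [set t | m t == 1%N]; rewrite !ffunE => ->.
have le_m : (U_(t) *+ 2 <= m)%MM.
  apply/mnm_lepP => u; rewrite mulmnE mnm1E; case: eqP => // <-.
  by rewrite mul1n.
rewrite -(submK le_m) mpolyXD idealMr // -mpolyXn.
by apply: AOT_ideal_gen; constructor.
Qed.

(** Multiples of squares have no squarefree terms, and each term of a multiple of f_L is divisible
    by |L| - 1 > |S| distinct variables. *)
Lemma AOT_ideal_coeff0 S p :
  (forall L (c : 'I_d -> K), dependent K G L -> nontrivial_relation G L c ->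
     (#|S|.+1 < #|L|)%N) ->
  p \in I -> p@_(mesym1 S) = 0.
Proof.
move=> bigL /asboolP[m [c [g [gP ->]]]]; rewrite raddf_sum big1 // => k _ /=.
case: (gP k) => [t | L b depL relL].
  rewrite mpolyXn mcoeffMX_eq0 //; apply/negP => /mnm_lepP/(_ t).
  by rewrite mulmnE mnm1E mnmE eqxx; case: (t \in S).
rewrite /OT_rel mulr_sumr raddf_sum big1 // => j Lj /=.
have -> : \prod_(t in L :\ j) 'X_t = 'X_[mesym1 (L :\ j)] :> {mpoly K[d]}.
  rewrite mprodXE; congr 'X_[_]; apply/mnmP => u.
  rewrite mnm_sumE mnmE (bigID (pred1 u)) /= [X in (_ + X)%N]big1; last first.
    by move=> t /andP[_ /negPf ne]; rewrite mnm1E ne.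
  rewrite addn0; case: (boolP (u \in L :\ j)) => uL.
    rewrite (bigD1 u) /= ?eqxx ?uL // mnm1E eqxx big1 // => t.
    by case/andP=> /andP[_ ->].
  by rewrite big1 // => t /andP[tL /eqP tu]; rewrite -tu tL in uL.
rewrite -scalerAr mcoeffZ mcoeffMX_eq0 ?mulr0 // mesym1_le.
have := bigL L b depL relL; rewrite (cardsD1 j L) Lj add1n ltnS => ltSL.
by apply/negP => /subset_leq_card; rewrite leqNgt ltSL.
Qed.

Hypothesis char0 : [pchar K] =i pred0.
(** Vacuous for forests; for cycle graphs [L] is the whole edge set. *)
Hypothesis big_relation : forall L (c : 'I_d -> K), dependent K G L ->
  nontrivial_relation G L c -> (2 < d <= #|L|)%N.

Lemma AOT_WLP : WLP I.
Proof.
exists (sum_vars K d) => [|i]; first exact: sum_vars_homog.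
have piM p q : \pi_A p * \pi_A q = \pi_A (p * q) by rewrite !piE.
case: (leqP i.+1.*2 d) => [le_id|lt_di]; [left|right].
  move=> _ _ [p hp ->] [q hq ->]; rewrite !piM => /pi_eqP.
  rewrite -mulrBr => Ilr.
  apply/pi_eqP; apply: sqfree0_AOT_ideal.
  have hr : p - q \is i.-homog by rewrite rpredB.
  apply: (up_inj char0 _ (sqfree_homog hr)).
    by rewrite card_ord (leq_trans _ le_id).
  rewrite -sqfree_mul_sum_vars; apply/ffunP => S; rewrite [RHS]ffunE.
  apply/eqP/negPn/negP => nz; have cardS := sqfree_homog (dhomogM (sum_vars_homog K d) hr) nz.
  case/eqP: nz; rewrite ffunE; apply: AOT_ideal_coeff0 Ilr => L c depL relL.
  have /andP[d_gt2 le_dL] := big_relation depL relL; rewrite cardS.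
  (* From 2(i + 1) <= d and d > 2 follows 2(i + 2) <= d + 2 < 2d. *)
  apply: leq_trans le_dL; rewrite -ltn_double doubleS -[d.*2]addnn.
  by rewrite (leq_ltn_trans (_ : _ <= d.+2)%N) // -addn2 ltn_add2l.
move=> _ [p hp ->].
have [|g hg pE] := up_surj (T := 'I_d) char0 _ (sqfree_homog hp).
  by rewrite card_ord.
(* A preimage in the model lifts to a homogeneous polynomial, correct modulo squares. *)
have [q hq qE] := sqfree_lift hg.
exists (\pi_A q); first by exists q.
rewrite piM; apply/pi_eqP; apply: sqfree0_AOT_ideal.
by rewrite sqfreeB sqfree_mul_sum_vars qE pE subrr.
Qed.

End AOTIdeal.

(** * Cycles in graphs and supports of linear relations *)

(* Extend a path backwards, never turning back along its first edge, until it
   meets itself. *)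
Lemma leafless_cycle (T : finType) (e : rel T) x0 y0 :
  ssrbool.symmetric e -> irreflexive e -> e x0 y0 ->
  (forall x y, e x y -> exists2 z, z != x & e y z) ->
  exists2 p, ucycle e p & (2 < size p)%N.
Proof.
move=> e_sym e_irr e0 e_turn.
(* The second alternative gives |T| + 2 distinct vertices, which counting excludes at the end. *)
have [//|[x [y [p [sz_p uniq_p _]]]]] :
  (exists2 p, ucycle e p & (2 < size p)%N) \/
  exists x y p, [/\ size p = #|T|, uniq [:: x, y & p] & path e x (y :: p)].
  elim: #|T| => [|k [IH|[x [y [p [sz_p uniq_p e_p]]]]]]; last 2 first.
  - by left.
  - have exy : e x y by case/andP: e_p.
    have [z ne_zy exz] : exists2 z, z != y & e x z.
      by apply: e_turn; rewrite e_sym.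
    have ne_zx : z != x by apply: contraTneq exz => ->; rewrite e_irr.
    have [pz|pz] := boolP (z \in p); last first.
      right; exists z, x, (y :: p); split; first by rewrite /= sz_p.
        by rewrite cons_uniq uniq_p !inE (negPf ne_zx) (negPf ne_zy) pz.
      by rewrite [path _ _ _]/= e_sym exz.
    (* The initial segment of the path up to [z] is closed by the edge from [z] to [x]; it contains
       x, y and z. *)
    left; case/splitPr: pz uniq_p e_p => p1 p2 uniq_p e_p {sz_p}.
    exists [:: x, y & rcons p1 z]; last by rewrite /= size_rcons.
    rewrite /ucycle; apply/andP; split.
      rewrite /= rcons_path last_rcons (e_sym z) exz andbT.
      by move: e_p; rewrite /= -cat_rcons cat_path; case/and3P=> -> ->.
    move: uniq_p; rewrite -cat_rcons -!cat_cons cat_uniq.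
    by case/andP.
  right; exists x0, y0, [::]; split; rewrite //= ?e0 // inE andbT.
  by apply: contraTneq e0 => ->; rewrite e_irr.
have := max_card (mem [:: x, y & p]).
by rewrite (card_uniqP uniq_p) /= sz_p ltnNge leqnSn.
Qed.

Lemma ordS_iter n (i j : 'I_n) : exists k, j = iter k (@ordS n) i.
Proof.
have val_iter k : iter k (@ordS n) i = ((i + k) %% n)%N :> nat.
  elim: k => [|k IHk]; first by rewrite addn0 modn_small.
  by rewrite iterS /= IHk -addn1 modnDml addn1 addnS.
(* Adding n keeps the subtraction from truncating and vanishes modulo n. *)
exists (j + n - i)%N; apply: val_inj; rewrite [RHS]val_iter subnKC.
  by rewrite modnDr modn_small.
by rewrite ltnW // (leq_trans (ltn_ord i)) // leq_addl.
Qed.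

Section Graph.
Variables (n d : nat) (G : graph n d).
Implicit Types (t u : 'I_d) (i j k : 'I_n).

Definition joins t i j := (G t == (i, j)) || (G t == (j, i)).

Lemma joinsC t i j : joins t i j = joins t j i.
Proof. by rewrite /joins orbC. Qed.

Lemma joins_neq t i j : joins t i j -> i != j.
Proof.
move=> /orP[]/eqP Gt; have := edge_lt G t; rewrite Gt /= => /ltn_eqF/negbT //.
by rewrite eq_sym.
Qed.

Lemma joins_inj t u i j : joins t i j -> joins u i j -> t = u.
Proof.
have := edge_lt G t; have := edge_lt G u.
move=> ltu ltt /orP[]/eqP Gt /orP[]/eqP Gu;
  try by apply: (@edge_inj _ _ G); rewrite Gt Gu.
  by move: ltt ltu; rewrite Gt Gu /= => /ltnW; rewrite leqNgt => /negPf ->.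
by move: ltt ltu; rewrite Gt Gu /= => /ltnW; rewrite leqNgt => /negPf ->.
Qed.

Section Relation.
Variables (K : fieldType) (L : {set 'I_d}) (c : 'I_d -> K).
Hypothesis relLc : nontrivial_relation G L c.

(** Coefficients may vanish on part of [L], so adjacency is taken in the support of the relation. *)
Definition supp_adj : rel 'I_n :=
  fun i j => [exists t, [&& t \in L, c t != 0 & joins t i j]].

Lemma supp_adj_sym : ssrbool.symmetric supp_adj.
Proof. by move=> i j; apply: eq_existsb => t; rewrite joinsC. Qed.

Lemma supp_adj_irr : irreflexive supp_adj.
Proof. by move=> i; apply/existsP => [[t /and3P[_ _ /joins_neq/eqP]]]. Qed.

Lemma supp_adj_adj i j : supp_adj i j -> adj G i j.
Proof. by case/existsP => t /and3P[_ _ ?]; apply/existsP; exists t. Qed.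

Lemma supp_adj_nonempty : exists i j, supp_adj i j.
Proof.
case: relLc => _ [t Lt ct]; exists (G t).1, (G t).2; apply/existsP; exists t.
by rewrite Lt ct /joins -surjective_pairing eqxx.
Qed.

(* Evaluating the relation at the basis vector of a vertex j: the nonzero
   coefficients of the edges at j cannot consist of a single one. *)
Lemma supp_adj_turn i j : supp_adj i j -> exists2 k, k != i & supp_adj j k.
Proof.
case/existsP => t /and3P[Lt ct tij].
have rel_j : \sum_(u in L) c u * ((j == (G u).1)%:R - (j == (G u).2)%:R) = 0 :> K.
  case: relLc => /lfunP/(_ (delta_mx 0 j)); rewrite sum_lfunE lfunE /= => E _.
  rewrite -[RHS]E; apply: eq_bigr => u _.
  by rewrite scale_lfunE ellE !mxE eqxx /= ![_ == j]eq_sym.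
have [u /and3P[Lu cu /andP[ne_ut ju]]] : exists u,
    [&& u \in L, c u != 0 & (u != t) && ((j == (G u).1) || (j == (G u).2))].
  apply/existsP; apply: contraTT (oner_neq0 K) => /existsPn none.
  move/eqP: rel_j; rewrite (bigD1 t) //= big1 ?addr0 => [|u /andP[Lu ne_ut]].
    have := joins_neq tij; rewrite eq_sym => /negPf ne_ji.
    case/orP: tij => /eqP -> /=; rewrite eqxx ne_ji ?sub0r ?subr0 ?mulrN1 ?mulr1;
    by rewrite ?oppr_eq0 (negPf ct).
  have := none u; rewrite Lu ne_ut /=.
  have [->|_] /= := eqVneq (c u) 0; first by rewrite mul0r.
  by case/norP=> /negPf-> /negPf->; rewrite subrr mulr0.
have [k ujk] : exists k, joins u j k.
  case/orP: ju => /eqP ->; [exists (G u).2|exists (G u).1];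
  by rewrite /joins -surjective_pairing eqxx ?orbT.
exists k; last by apply/existsP; exists u; rewrite Lu cu.
(* If k were i, then [u] and [t] would have the same ends. *)
apply: contraNneq ne_ut => ki; apply/eqP/(joins_inj (i := j) (j := i)).
  by rewrite -ki.
by rewrite joinsC.
Qed.

(** An edge ij of the support continues at both ends, by jk with k != i and by il with l != j; these
    three edges are distinct. *)
Lemma relation_card : (2 < #|L|)%N.
Proof.
have [i [j ij]] := supp_adj_nonempty.
have [k ne_ki jk] := supp_adj_turn ij.
have [l ne_lj il] : exists2 l, l != j & supp_adj i l.
  by apply: supp_adj_turn; rewrite supp_adj_sym.
case/existsP: ij => t /and3P[Lt _ tij].
case/existsP: jk => u /and3P[Lu _ ujk].
case/existsP: il => v /and3P[Lv _ vil].
have meet (x y x' y' : 'I_n) w : joins w x y -> joins w x' y' -> (x == x') || (x == y').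
  by rewrite /joins => /orP[]/eqP-> /orP[]/eqP[e1 e2]; rewrite ?e1 ?e2 eqxx ?orbT.
have ne_ij := joins_neq tij.
suff sub : uniq [:: t; u; v].
  apply: (@leq_trans #|mem [:: t; u; v]|); first by rewrite (card_uniqP sub).
  apply: subset_leq_card; apply/subsetP => w.
  by rewrite !inE => /or3P[]/eqP->.
rewrite /= !inE !negb_or -andbA andbT; apply/and3P; split.
- apply: contraTneq ujk => <-; apply/negP => tjk.
  by have := meet _ _ _ _ _ tij tjk; rewrite (negPf ne_ij) eq_sym (negPf ne_ki).
- apply: contraTneq vil => <-; apply/negP => til; rewrite joinsC in tij.
  by have := meet _ _ _ _ _ tij til; rewrite eq_sym (negPf ne_ij) eq_sym (negPf ne_lj).
apply: contraTneq vil => <-; apply/negP => uil.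
by have := meet _ _ _ _ _ uil ujk; rewrite (negPf ne_ij) eq_sym (negPf ne_ki).
Qed.

(** The support has no vertex of degree 1, so it contains a cycle, which is also a cycle of [G]. *)
Lemma forest_no_relation : ~ is_forest G.
Proof.
move=> forestG; have [i [j ij]] := supp_adj_nonempty.
have [p /andP[cyc_p uniq_p]] :=
  leafless_cycle supp_adj_sym supp_adj_irr ij supp_adj_turn.
rewrite ltnNge -ltnS forestG //; apply/andP; split=> //.
by apply: sub_cycle cyc_p; exact: supp_adj_adj.
Qed.

(** A vertex of the cycle has only two neighbours, so the support, unable to turn back, runs along
    the cycle through all edges. *)
Lemma cycle_relation_full : is_cycle_graph G -> L = [set: 'I_d].
Proof.
case=> _ [s adj_s].
have step i : supp_adj (s i) (s (ordS i)) ->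
    supp_adj (s (ordS i)) (s (ordS (ordS i))).
  case/supp_adj_turn => k; rewrite -(permKV s k) (inj_eq perm_inj) => ne_ki ij.
  have := supp_adj_adj ij; rewrite adj_s.
  case/orP=> [/eqP <- //|/eqP/(can_inj (@ordSK n)) E].
  by rewrite E eqxx in ne_ki.
have [i ii] : exists i, supp_adj (s i) (s (ordS i)).
  have [x [y]] := supp_adj_nonempty; rewrite -(permKV s x) -(permKV s y) => xy.
  have := supp_adj_adj xy; rewrite adj_s => /orP[]/eqP E.
    by exists (s^-1%g x); rewrite -E.
  by exists (s^-1%g y); rewrite -E supp_adj_sym.
have all_steps j : supp_adj (s j) (s (ordS j)).
  have [k ->] := ordS_iter i j; elim: k => [//|k IHk]; exact: step.
apply/setP => t; rewrite inE.
pose x := (s^-1)%g (G t).1; pose y := (s^-1)%g (G t).2.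
have txy : joins t (s x) (s y) by rewrite !permKV /joins -surjective_pairing eqxx.
have : supp_adj (s x) (s y).
  suff : adj G (s x) (s y).
    rewrite adj_s => /orP[]/eqP ->; last rewrite supp_adj_sym; exact: all_steps.
  by apply/existsP; exists t.
by case/existsP => u /and3P[Lu _ /(joins_inj txy)->].
Qed.

End Relation.
End Graph.

Theorem proposition3p5 (K : fieldType) (char0 : ([pchar K] =i pred0)%R)
    (n d : nat) (G : graph n d) (hG : is_forest G \/ is_cycle_graph G) :
  WLP (AOT_ideal K G).
Proof.
apply: AOT_WLP char0 _ => L c _ relLc.
case: hG => [/(forest_no_relation relLc)//|cycG].
have := relation_card relLc.
by rewrite (cycle_relation_full relLc cycG) cardsT card_ord leqnn andbT.
Qed.
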